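(* Let $(A,\cdot,\{~,~,~\},\{\!\{~,~,~\}\!\})$ be an associative-Yamaguti algebra. For $a,b\in A$ let $\sigma_{a,b},\tau_{a,b}\in\mathrm{End}(A)$ be the linear maps $\sigma_{a,b}(c)=\{a,b,c\}$ and $\tau_{a,b}(c)=\{\!\{c,a,b\}\!\}$, and let $\mathcal{M}(A)$ be the vector subspace of $\mathrm{End}(A)\oplus\mathrm{End}(A)$ spanned by the set $\{(\sigma_{a,b},\tau_{a,b})\mid a,b\in A\}$. (i) $(\mathcal{M}(A),* )$ is an associative algebra, where $*$ is the bilinear operation determined by $$(\sigma_{a,b},\tau_{a,b})*(\sigma_{c,d},\tau_{c,d})=(\sigma_{\{a,b,c\},d},\tau_{\{a,b,c\},d}).$$ (ii) Define linear maps $\triangleright:\mathcal{M}(A)\otimes A\to A$ and $\triangleleft:A\otimes\mathcal{M}(A)\to A$ by $$(\sigma_{a,b},\tau_{a,b})\triangleright c=\sigma_{a,b}(c)=\{a,b,c\},\qquad c\triangleleft(\sigma_{a,b},\tau_{a,b})=\tau_{a,b}(c)=\{\!\{c,a,b\}\!\}.$$ With these action maps, $A$ is a bimodule over the associative algebra $(\mathcal{M}(A),* )$, and for all $a,b\in A$, $\xi\in\mathcal{M}(A)$, $$\xi\triangleright(a\cdot b)=(\xi\triangleright a)\cdot b,\quad (a\cdot b)\triangleleft\xi=a\cdot(b\triangleleft\xi),\quad a\cdot(\xi\triangleright b)=(a\triangleleft\xi)\cdot b.$$ (iii) Define $\Delta:A\otimes A\to\mathcal{M}(A)$ by $\Delta(a,b)=(\sigma_{a,b},\tau_{a,b})$.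 Then for all $a,b,c\in A$ and $\xi\in\mathcal{M}(A)$, $$\Delta(a,b)\triangleright c=\{a,b,c\},\qquad a\triangleleft\Delta(b,c)=\{\!\{a,b,c\}\!\},$$ $$\xi*\Delta(a,b)=\Delta(\xi\triangleright a,b),\quad \Delta(a,b)*\xi=\Delta(a,b\triangleleft\xi),\quad \Delta(a,\xi\triangleright b)=\Delta(a\triangleleft\xi,b),$$ $$\Delta(a\cdot b,c)=\Delta(a,b\cdot c).$$ As a consequence, $(\mathcal{M}(A)\oplus A,\circledast)$ is a reductive associative algebra (with respect to the decomposition into $\mathcal{M}(A)$ and $A$), where $\circledast$ is the bilinear operation determined by $$(\sigma_{a,b},\tau_{a,b},x)\circledast(\sigma_{c,d},\tau_{c,d},y)=\big(\sigma_{\{a,b,c\},d}+\sigma_{x,y},\ \tau_{\{a,b,c\},d}+\tau_{x,y},\ \{a,b,y\}+\{\!\{x,c,d\}\!\}+x\cdot y\big).$$ Further, the associative-Yamaguti algebra structure on $A$ induced from this reductive associative algebra coincides with the given one.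
   Context: All vector spaces, linear maps and tensor products are over a field $\mathbf{k}$ of characteristic $0$. Associative algebras are not assumed unital. An associative-Yamaguti algebra is a quadruple $(A,\cdot,\{~,~,~\},\{\!\{~,~,~\}\!\})$ consisting of a vector space $A$ with linear operations $\cdot:A\otimes A\to A$ and $\{~,~,~\},\{\!\{~,~,~\}\!\}:A\otimes A\otimes A\to A$ such that for all $a,b,c,d,e\in A$: (AY1) $(a\cdot b)\cdot c-a\cdot(b\cdot c)+\{a,b,c\}-\{\!\{a,b,c\}\!\}=0$; (AY2) $\{a\cdot b,c,d\}=\{a,b\cdot c,d\}$; (AY3) $\{a,b,c\cdot d\}=\{a,b,c\}\cdot d$; (AY4) $\{\!\{a\cdot b,c,d\}\!\}=a\cdot\{\!\{b,c,d\}\!\}$; (AY5) $\{\!\{a,b\cdot c,d\}\!\}=\{\!\{a,b,c\cdot d\}\!\}$; (AY6) $a\cdot\{b,c,d\}=\{\!\{a,b,c\}\!\}\cdot d$; (AY7) $\{\{a,b,c\},d,e\}=\{a,\{\!\{b,c,d\}\!\},e\}=\{a,b,\{c,d,e\}\}$; (AY8) $\{a,\{b,c,d\},e\}=\{\{\!\{a,b,c\}\!\},d,e\}$; (AY9) $\{\!\{\{\!\{a,b,c\}\!\},d,e\}\!\}=\{\!\{a,\{b,c,d\},e\}\!\}=\{\!\{a,b,\{\!\{c,d,e\}\!\}\}\!\}$; (AY10) $\{\!\{a,\{\!\{b,c,d\}\!\},e\}\!\}=\{\!\{a,b,\{c,d,e\}\}\!\}$; (AY11) $\{a,b,\{\!\{c,d,e\}\!\}\}=\{\!\{\{a,b,c\},d,e\}\!\}$.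 A reductive associative algebra is an associative algebra $(C,\circledast)$ with a direct sum decomposition $C=C_0\oplus C_1$ of vector spaces such that $C_0\circledast C_0\subset C_0$, $C_0\circledast C_1\subset C_1$ and $C_1\circledast C_0\subset C_1$. With $\mathrm{pr}_{C_0},\mathrm{pr}_{C_1}$ the projections, the induced associative-Yamaguti algebra structure on $C_1$ is: $a\bullet b=\mathrm{pr}_{C_1}(a\circledast b)$, $\{a,b,c\}=(\mathrm{pr}_{C_0}(a\circledast b))\circledast c$, $\{\!\{a,b,c\}\!\}=a\circledast(\mathrm{pr}_{C_0}(b\circledast c))$ for $a,b,c\in C_1$. *)

(* Defs.v *)
From HB Require Import structures.
From mathcomp Require Import all_boot all_order all_algebra.
From mathcomp Require Import sesquilinear boolp classical_sets.
(* for the eqType and choiceType structures on {linear U -> V} *)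
From mathcomp Require Import prodnormedzmodule.

Set Implicit Arguments.
Unset Strict Implicit.
Unset Printing Implicit Defensive.

Import GRing.Theory.
Local Open Scope ring_scope.
Local Open Scope classical_set_scope.

Section LinearMapSpace.
Context {R : comNzRingType} {U V : lmodType R}.
Implicit Types f g h : {linear U -> V}.

Lemma linear_mapP f g : f =1 g -> f = g.
Proof.
move=> /funext; case: f => f cf; case: g => g cg /= efg.
case: _ / efg in cg *; case: cf cg => [[p] [q]] [[p'] [q']].
by rewrite (Prop_irrelevance p p') (Prop_irrelevance q q').
Qed.

Definition linear_add f g : {linear U -> V} := f \+ g.
Definition linear_opp f : {linear U -> V} := \- f.
Definition linear_scale (c : R) f : {linear U -> V} := c \*: f.

Fact linear_addA : associative linear_add.
Proof. by move=> f g h; apply: linear_mapP => x /=; rewrite addrA. Qed.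
Fact linear_addC : commutative linear_add.
Proof. by move=> f g; apply: linear_mapP => x /=; rewrite addrC. Qed.
Fact linear_add0 : left_id (\0 : {linear U -> V}) linear_add.
Proof. by move=> f; apply: linear_mapP => x /=; rewrite add0r. Qed.
Fact linear_addN : left_inverse (\0 : {linear U -> V}) linear_opp linear_add.
Proof. by move=> f; apply: linear_mapP => x /=; rewrite addNr. Qed.

HB.instance Definition _ := GRing.isZmodule.Build {linear U -> V}
  linear_addA linear_addC linear_add0 linear_addN.

Fact linear_scaleA a b f :
  linear_scale a (linear_scale b f) = linear_scale (a * b) f.
Proof. by apply: linear_mapP => x /=; rewrite scalerA. Qed.
Fact linear_scale1 : left_id 1 linear_scale.
Proof. by move=> f; apply: linear_mapP => x /=; rewrite scale1r. Qed.
Fact linear_scaleDr : right_distributive linear_scale +%R.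
Proof. by move=> a f g; apply: linear_mapP => x /=; rewrite scalerDr. Qed.
Fact linear_scaleDl f : {morph linear_scale^~ f : a b / a + b}.
Proof. by move=> a b; apply: linear_mapP => x /=; rewrite scalerDl. Qed.

HB.instance Definition _ := GRing.Zmodule_isLmodule.Build R {linear U -> V}
  linear_scaleA linear_scale1 linear_scaleDr linear_scaleDl.

End LinearMapSpace.

(* The subspace spanned by an arbitrary (possibly infinite) set of vectors,   *)
(* as a type; vector.v only has spans of finite sequences.                    *)
Section Span.
Context {K : fieldType} {V : lmodType K} (S : set V).

Definition in_span (v : V) : Prop :=
  exists (n : nat) (c : 'I_n -> K) (w : 'I_n -> V),
    (forall i, S (w i)) /\ v = \sum_(i < n) c i *: w i.

Definition span : {pred V} := fun v => `[< in_span v >].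

Fact span_submod_closed : submod_closed span.
Proof.
split=> [|a _ _ /asboolP[n [c [w [Sw ->]]]] /asboolP[m [d [u [Su ->]]]]].
  apply/asboolP; exists 0%N, (fun=> 0), (fun=> 0).
  by split=> [[]|] //; rewrite big_ord0.
apply/asboolP; exists (n + m)%N.
exists (fun i => match fintype.split i with inl j => a * c j | inr j => d j end).
exists (fun i => match fintype.split i with inl j => w j | inr j => u j end).
split=> [i|]; first by case: fintype.split.
rewrite big_split_ord scaler_sumr; congr (_ + _); apply: eq_bigr => i _.
  by rewrite -[lshift _ i]/(unsplit (inl i)) unsplitK scalerA.
by rewrite -[rshift _ i]/(unsplit (inr i)) unsplitK.
Qed.

HB.instance Definition _ :=
  GRing.isSubmodClosed.Build K V span (GRing.subsemimod_closed_submod span_submod_closed).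

Record span_of := SpanOf { span_val : V; _ : span_val \in span }.

HB.instance Definition _ := [isSub for span_val].
HB.instance Definition _ := [Choice of span_of by <:].
HB.instance Definition _ := [SubChoice_isSubLmodule of span_of by <:].

Lemma mem_span v : S v -> v \in span.
Proof.
move=> Sv; apply/asboolP; exists 1%N, (fun=> 1), (fun=> v).
by split=> //; rewrite big_ord1 scale1r.
Qed.

End Span.

Definition bilinear_op {K : fieldType} {U V W : lmodType K} (f : U -> V -> W)
    : Prop :=
  (forall v, linear (f^~ v)) /\ (forall u, linear (f u)).

Definition trilinear_op {K : fieldType} {V : lmodType K} (t : V -> V -> V -> V)
    : Prop :=
  [/\ forall b c, linear (fun a => t a b c),
      forall a c, linear (fun b => t a b c)
    & forall a b, linear (fun c => t a b c)].

(* [br a, b, c] stands for {a,b,c} and [dbr a, b, c] for {{a,b,c}}.           *)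
Reserved Notation "x *y y" (at level 40, left associativity).
Reserved Notation "[br x , y , z ]"
  (at level 0, x, y, z at level 99, format "[br  x ,  y ,  z ]").
Reserved Notation "[dbr x , y , z ]"
  (at level 0, x, y, z at level 99, format "[dbr  x ,  y ,  z ]").

HB.mixin Record Lmodule_isAssocYamaguti (K : fieldType) (A : Type)
    of GRing.Lmodule K A := {
  aymul : A -> A -> A;
  aybr : A -> A -> A -> A;
  aydbr : A -> A -> A -> A;
  aymul_bilinear : bilinear_op aymul;
  aybr_trilinear : trilinear_op aybr;
  aydbr_trilinear : trilinear_op aydbr;
  ay1 : forall a b c,
    aymul (aymul a b) c - aymul a (aymul b c) + aybr a b c - aydbr a b c = 0;
  ay2 : forall a b c d, aybr (aymul a b) c d = aybr a (aymul b c) d;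
  ay3 : forall a b c d, aybr a b (aymul c d) = aymul (aybr a b c) d;
  ay4 : forall a b c d, aydbr (aymul a b) c d = aymul a (aydbr b c d);
  ay5 : forall a b c d, aydbr a (aymul b c) d = aydbr a b (aymul c d);
  ay6 : forall a b c d, aymul a (aybr b c d) = aymul (aydbr a b c) d;
  ay7 : forall a b c d e,
    aybr (aybr a b c) d e = aybr a (aydbr b c d) e /\
    aybr a (aydbr b c d) e = aybr a b (aybr c d e);
  ay8 : forall a b c d e, aybr a (aybr b c d) e = aybr (aydbr a b c) d e;
  ay9 : forall a b c d e,
    aydbr (aydbr a b c) d e = aydbr a (aybr b c d) e /\
    aydbr a (aybr b c d) e = aydbr a b (aydbr c d e);
  ay10 : forall a b c d e, aydbr a (aydbr b c d) e = aydbr a b (aybr c d e);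
  ay11 : forall a b c d e, aybr a b (aydbr c d e) = aydbr (aybr a b c) d e
}.

#[short(type="assocYamagutiType")]
HB.structure Definition AssocYamaguti (K : fieldType) :=
  {A of Lmodule_isAssocYamaguti K A & GRing.Lmodule K A}.

Notation "x *y y" := (aymul x y) : ring_scope.
Notation "[br x , y , z ]" := (aybr x y z) : ring_scope.
Notation "[dbr x , y , z ]" := (aydbr x y z) : ring_scope.

Section InnerMaps.
Context {K : fieldType} {A : assocYamagutiType K}.
Implicit Types a b : A.

Definition sigma_fun a b : A -> A := fun c => [br a, b, c].
Definition tau_fun a b : A -> A := fun c => [dbr c, a, b].

Fact sigma_linear a b : linear (sigma_fun a b).
Proof. by case: (@aybr_trilinear K A) => _ _; exact. Qed.
Fact tau_linear a b : linear (tau_fun a b).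
Proof. by case: (@aydbr_trilinear K A) => + _ _; exact. Qed.

HB.instance Definition _ a b :=
  GRing.isLinear.Build K A A *:%R (sigma_fun a b) (sigma_linear a b).
HB.instance Definition _ a b :=
  GRing.isLinear.Build K A A *:%R (tau_fun a b) (tau_linear a b).

Definition sigma a b : {linear A -> A} := sigma_fun a b.
Definition tau a b : {linear A -> A} := tau_fun a b.

Definition sigma_tau_pairs : set ({linear A -> A} * {linear A -> A}) :=
  [set p | exists a b, p = (sigma a b, tau a b)].

End InnerMaps.

Definition innerM {K : fieldType} (A : assocYamagutiType K) : lmodType K :=
  span_of (@sigma_tau_pairs K A).

Fact sigma_tau_in_span {K : fieldType} {A : assocYamagutiType K} (a b : A) :
  (sigma a b, tau a b) \in span (@sigma_tau_pairs K A).
Proof. by apply: mem_span; exists a, b. Qed.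

Definition Delta {K : fieldType} {A : assocYamagutiType K} (a b : A) : innerM A :=
  SpanOf (sigma_tau_in_span a b).

Section Algebras.
Context {K : fieldType}.

Definition assoc_algebra {C : lmodType K} (mul : C -> C -> C) : Prop :=
  bilinear_op mul /\ associative mul.

Record bimodule {B M : lmodType K} (mul : B -> B -> B)
    (lact : B -> M -> M) (ract : M -> B -> M) : Prop := Bimodule {
  lact_bilinear : bilinear_op lact;
  ract_bilinear : bilinear_op ract;
  lactA : forall x y m, lact (mul x y) m = lact x (lact y m);
  ractA : forall m x y, ract m (mul x y) = ract (ract m x) y;
  lractA : forall x m y, ract (lact x m) y = lact x (ract m y)
}.

Definition direct_sum {C : lmodType K} (C0 C1 : {pred C}) : Prop :=
  forall x : C, exists! p : C * C,
    [/\ p.1 \in C0, p.2 \in C1 & x = p.1 + p.2].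

Record reductive {C : lmodType K} (mul : C -> C -> C) (C0 C1 : {pred C})
    : Prop := Reductive {
  reductive_algebra : assoc_algebra mul;
  reductive_sub0 : submod_closed C0;
  reductive_sub1 : submod_closed C1;
  reductive_sum : direct_sum C0 C1;
  reductive00 : {in C0 & C0, forall x y, mul x y \in C0};
  reductive01 : {in C0 & C1, forall x y, mul x y \in C1};
  reductive10 : {in C1 & C0, forall x y, mul x y \in C1}
}.

(* Projection onto D along E; meaningful when the ambient space is the direct *)
(* sum of D and E.                                                            *)
Definition proj_along {C : lmodType K} (D E : {pred C}) (x : C) : C :=
  xget 0 [set u | u \in D /\ x - u \in E].

(* The operations induced on C1; they are meant for arguments in C1 only.     *)
Section Induced.
Context {C : lmodType K} (mul : C -> C -> C) (C0 C1 : {pred C}).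

Definition induced_mul (a b : C) : C := proj_along C1 C0 (mul a b).
Definition induced_br (a b c : C) : C := mul (proj_along C0 C1 (mul a b)) c.
Definition induced_dbr (a b c : C) : C := mul a (proj_along C0 C1 (mul b c)).

End Induced.

End Algebras.

(* Main.v *)
Require Import Defs.
From HB Require Import structures.
From mathcomp Require Import all_boot all_order all_algebra.
From mathcomp Require Import sesquilinear boolp classical_sets.

Set Implicit Arguments.
Unset Strict Implicit.
Unset Printing Implicit Defensive.

Import GRing.Theory.
Local Open Scope ring_scope.

(** Everything rests on realising $\xi * \eta$ as the pair of composites (left
    parts in order, right parts in reverse order): the associativity of $*$ and
    of each action is then that of composition, and the span enters only
    through closure and uniqueness.  The axioms (AY2)--(AY11) say that the
    actions, $\cdot$ and $\Delta$ are compatible on the generators, and the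
    associativity of $\circledast$ is the sum of these compatibilities and
    (AY1). *)

(** * Additivity and vanishing for bilinear operations *)

Section BilinearOp.
Context {K : fieldType} {U V W : lmodType K} {f : U -> V -> W}.
Context (f_bilinear : bilinear_op f).

(** [linear] bundles scaling with addition; additivity is its case of scalar $1$. *)
Lemma bilinear_opD :
  (forall u u' v, f (u + u') v = f u v + f u' v) /\
  (forall u v v', f u (v + v') = f u v + f u v').
Proof.
have [fl fr] := f_bilinear; split=> [u u' v|u v v'].
  by rewrite -{1}[u]scale1r fl scale1r.
by rewrite -{1}[v]scale1r fr scale1r.
Qed.

Lemma bilinear_op0 : (forall v, f 0 v = 0) /\ (forall u, f u 0 = 0).
Proof.
have [fDl fDr] := bilinear_opD.
split=> [v|u]; first by apply: (addrI (f 0 v)); rewrite -fDl !addr0.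
by apply: (addrI (f u 0)); rewrite -fDr !addr0.
Qed.

End BilinearOp.

(** * The coordinate decomposition of a product space *)

Section ProductDecomposition.
Context {K : fieldType} {U V : lmodType K}.
Let M0 : {pred U * V} := [pred z | z.2 == 0].
Let M1 : {pred U * V} := [pred z | z.1 == 0].

Lemma direct_sum_prod : direct_sum M0 M1.
Proof.
move=> [u v]; exists ((u, 0), (0, v)); split.
  by split; rewrite ?inE //=; congr pair; rewrite /= ?addr0 ?add0r.
move=> [[u0 v0] [u1 v1]] [/=]; rewrite !inE /= => /eqP-> /eqP-> [-> ->].
by rewrite addr0 add0r.
Qed.

(** [proj_along] selects its value by choice; the two membership conditions fix both coordinates of
    any candidate, so the choice is forced. *)
Lemma proj_along_fst z : proj_along M0 M1 z = (z.1, 0).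
Proof.
apply: xget_unique => [|[u v] [/=]].
  by split; rewrite inE //= subrr.
by rewrite !inE /= subr_eq0 => /eqP-> /eqP->.
Qed.

Lemma proj_along_snd z : proj_along M1 M0 z = (0, z.2).
Proof.
apply: xget_unique => [|[u v] [/=]].
  by split; rewrite inE //= subrr.
by rewrite !inE /= subr_eq0 => /eqP-> /eqP->.
Qed.

End ProductDecomposition.

(** * The actions of $\mathcal{M}(A)$, the map $\Delta$, and extension from generators *)

Section InnerAlgebra.
Context {K : fieldType} {A : assocYamagutiType K}.
Implicit Types (a b c d x y z : A) (xi eta zeta : innerM A).

Lemma aymul_linearl b : linear (fun a => a *y b).
Proof. by case: (@aymul_bilinear K A). Qed.

Lemma aymul_linearr a : linear (fun b => a *y b).
Proof. by case: (@aymul_bilinear K A). Qed.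

(** Evaluating the pair itself avoids any choice of a linear combination of generators, so
    well-definedness is not an issue. *)
Definition lact xi a : A := (val xi).1 a.
Definition ract a xi : A := (val xi).2 a.

(** The two actions are jointly faithful, which turns every identity in $\mathcal{M}(A)$ into two
    identities in $A$. *)
Lemma innerM_eqP xi eta :
  lact xi =1 lact eta -> ract^~ xi =1 ract^~ eta -> xi = eta.
Proof.
rewrite /lact /ract => el er; apply: val_inj.
rewrite [LHS]surjective_pairing [RHS]surjective_pairing.
by congr pair; apply: linear_mapP.
Qed.

Lemma lact_bilinear : bilinear_op lact.
Proof.
split=> [a k xi eta|xi k a b]; last by rewrite /lact linearP.
by rewrite /lact linearP.
Qed.

Lemma ract_bilinear : bilinear_op ract.
Proof.
split=> [xi k a b|a k xi eta]; first by rewrite /ract linearP.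
by rewrite /ract linearP.
Qed.

Lemma lact_Delta a b c : lact (Delta a b) c = [br a, b, c].
Proof. by []. Qed.

Lemma ract_Delta a b c : ract a (Delta b c) = [dbr a, b, c].
Proof. by []. Qed.

Lemma Delta_bilinear : bilinear_op (Delta : A -> A -> innerM A).
Proof.
have [brl brm _] := @aybr_trilinear K A.
have [_ dbrm dbrr] := @aydbr_trilinear K A.
have [ll _] := lact_bilinear; have [_ rr] := ract_bilinear.
split=> [b k a a'|a k b b']; apply: innerM_eqP => x.
- by rewrite ll; apply: brl.
- by rewrite rr; apply: dbrm.
- by rewrite ll; apply: brm.
- by rewrite rr; apply: dbrr.
Qed.

(** Induction on the length of a combination of generators; the closure hypothesis has the shape of
    [linear], so linear identities fit it directly. *)
Lemma innerM_ind (P : innerM A -> Prop) :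
    (forall a b, P (Delta a b)) ->
    (forall k xi eta, P xi -> P eta -> P (k *: xi + eta)) ->
  forall xi, P xi.
Proof.
move=> PDelta Plin.
have P0 : P 0.
  (* The empty combination is covered by $0 = (-1)\Delta(0,0) + \Delta(0,0)$. *)
  by rewrite -(subrr (Delta 0 0)) addrC -scaleN1r; apply: Plin; apply: PDelta.
case=> v v_span; have /asboolP[n [k [w [Sw def_v]]]] := v_span.
(* The induction concerns bare vectors and builds the span element along with each partial sum;
   which membership proof it carries is immaterial. *)
suff [xi val_xi Pxi] : exists2 xi, val xi = v & P xi.
  by rewrite (_ : SpanOf _ = xi) //; apply: val_inj.
rewrite {v v_span}def_v; elim: n => [|n IHn] in k w Sw *.
  by exists 0 => //; rewrite big_ord0 linear0.
rewrite big_ord_recl.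
have [|xi <- Pxi] := IHn (fun i => k (lift ord0 i)) (fun i => w (lift ord0 i)).
  by move=> i; apply: Sw.
have [a [b ->]] := Sw ord0.
by exists (k ord0 *: Delta a b + xi); [rewrite linearP | apply: Plin].
Qed.

Lemma linear_ext (W : lmodType K) (f g : innerM A -> W) :
  linear f -> linear g -> (forall a b, f (Delta a b) = g (Delta a b)) -> f =1 g.
Proof.
move=> lf lg efg; elim/innerM_ind=> [a b|k xi eta IHxi IHeta]; first exact: efg.
by rewrite lf lg IHxi IHeta.
Qed.

(** The whole $A$-component goes to the last summand, so the induction hypothesis is used at $0$ and
    at $x$; hence $x$ stays general. *)
Lemma linear_ext_sum (W : lmodType K) (f g : innerM A * A -> W) :
    linear f -> linear g ->
    (forall a b x, f (Delta a b, x) = g (Delta a b, x)) ->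
  f =1 g.
Proof.
move=> lf lg efg [xi x].
elim/innerM_ind: xi => [a b|k xi eta IHxi IHeta] in x *.
  exact: efg.
have -> : (k *: xi + eta, x) = k *: (xi, 0) + (eta, x).
  by congr pair; rewrite /= scaler0 add0r.
by rewrite lf lg IHxi IHeta.
Qed.

(** * The product on $\mathcal{M}(A)$ *)

Definition star_val xi eta : {linear A -> A} * {linear A -> A} :=
  ((val xi).1 \o (val eta).1 : {linear A -> A},
   (val eta).2 \o (val xi).2 : {linear A -> A}).

(** Composition is bilinear, and (AY7) and (AY9) make the composite of two generators again a
    generator. *)
Fact star_val_span xi eta :
  star_val xi eta \in Defs.span (@sigma_tau_pairs K A).
Proof.
have val_lin (u v : innerM A) k : val (k *: u + v) = k *: val u + val v.
  exact: linearP.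
elim/innerM_ind: xi => [a b|k xi xi' IHxi IHxi']; last first.
  suff -> : star_val (k *: xi + xi') eta =
      k *: star_val xi eta + star_val xi' eta.
    by rewrite rpredD ?rpredZ.
  rewrite /star_val val_lin; congr pair; apply: linear_mapP => x //=.
  by rewrite linearP.
elim/innerM_ind: eta => [c d|k eta eta' IHeta IHeta']; last first.
  suff -> : star_val (Delta a b) (k *: eta + eta') =
      k *: star_val (Delta a b) eta + star_val (Delta a b) eta'.
    by rewrite rpredD ?rpredZ.
  rewrite /star_val val_lin; congr pair; apply: linear_mapP => x //=.
  by rewrite -[LHS]/(sigma a b _) linearP.
suff -> : star_val (Delta a b) (Delta c d) = val (Delta [br a, b, c] d).
  exact: valP.
congr pair; apply: linear_mapP => x /=.
  by have [e1 e2] := ay7 a b c d x; exact: esym (etrans e1 e2).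
by have [e1 _] := ay9 x a b c d; exact: e1.
Qed.

Definition star xi eta : innerM A := SpanOf (star_val_span xi eta).

Lemma lact_star xi eta a : lact (star xi eta) a = lact xi (lact eta a).
Proof. by []. Qed.

Lemma ract_star xi eta a : ract a (star xi eta) = ract (ract a xi) eta.
Proof. by []. Qed.

Lemma star_algebra : assoc_algebra star.
Proof.
have [ll lr] := lact_bilinear; have [rl rr] := ract_bilinear.
split; last by move=> xi eta zeta; apply: innerM_eqP.
split=> [eta k xi xi'|xi k eta eta']; apply: innerM_eqP => x.
- by rewrite ll !lact_star ll.
- by rewrite rr !ract_star rr rl.
- by rewrite ll !lact_star ll lr.
- by rewrite rr !ract_star rr.
Qed.

(** * Compatibility of the actions with $\cdot$, with each other and with $\Delta$ *)

Lemma lact_mul xi a b : lact xi (a *y b) = lact xi a *y b.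
Proof.
have [ll _] := lact_bilinear.
apply: (linear_ext (f := lact^~ (a *y b)) (g := fun xi => lact xi a *y b)).
- exact: ll.
- by move=> k eta zeta; rewrite ll aymul_linearl.
- by move=> c d; apply: ay3.
Qed.

Lemma mul_ract xi a b : ract (a *y b) xi = a *y ract b xi.
Proof.
have [_ rr] := ract_bilinear.
apply: (linear_ext (f := ract (a *y b)) (g := fun xi => a *y ract b xi)).
- exact: rr.
- by move=> k eta zeta; rewrite rr aymul_linearr.
- by move=> c d; apply: ay4.
Qed.

Lemma mul_lact xi a b : a *y lact xi b = ract a xi *y b.
Proof.
have [ll _] := lact_bilinear; have [_ rr] := ract_bilinear.
apply: (linear_ext (f := fun xi => a *y lact xi b)
                   (g := fun xi => ract a xi *y b)).
- by move=> k eta zeta; rewrite ll aymul_linearr.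
- by move=> k eta zeta; rewrite rr aymul_linearl.
- by move=> c d; apply: ay6.
Qed.

Lemma lact_ract xi a eta : ract (lact xi a) eta = lact xi (ract a eta).
Proof.
have [ll lr] := lact_bilinear; have [rl rr] := ract_bilinear.
apply: (linear_ext (f := fun xi => ract (lact xi a) eta)
                   (g := fun xi => lact xi (ract a eta))).
- by move=> k u v; rewrite ll rl.
- by move=> k u v; rewrite ll.
move=> c d.
apply: (linear_ext (f := ract (lact (Delta c d) a))
                   (g := fun eta => lact (Delta c d) (ract a eta))).
- exact: rr.
- by move=> k u v; rewrite rr lr.
by move=> x y; symmetry; apply: ay11.
Qed.

Lemma innerM_bimodule : bimodule star lact ract.
Proof.
split=> //; [exact: lact_bilinear | exact: ract_bilinear|].
by move=> *; apply: lact_ract.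
Qed.

(** At a generator [xi] this is the prescribed formula for $*$. The left actions agree by the outer
    terms of (AY7), the right ones by the first equality of (AY9). *)
Lemma star_Delta xi a b : star xi (Delta a b) = Delta (lact xi a) b.
Proof.
have [[sl _] _] := star_algebra; have [ll _] := lact_bilinear.
have [Dl _] := Delta_bilinear.
apply: (linear_ext (f := star^~ (Delta a b))
                   (g := fun xi => Delta (lact xi a) b)).
- exact: sl.
- by move=> k u v; rewrite ll Dl.
move=> c d; apply: innerM_eqP => x.
  by have [e1 e2] := ay7 c d a b x; exact: esym (etrans e1 e2).
by have [e1 _] := ay9 x c d a b; exact: e1.
Qed.

(** Here the roles swap: the second equality of (AY7) and the outer terms of (AY9). *)
Lemma Delta_star xi a b : star (Delta a b) xi = Delta a (ract b xi).
Proof.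
have [[_ sr] _] := star_algebra; have [_ rr] := ract_bilinear.
have [_ Dr] := Delta_bilinear.
apply: (linear_ext (f := star (Delta a b))
                   (g := fun xi => Delta a (ract b xi))).
- exact: sr.
- by move=> k u v; rewrite rr Dr.
move=> c d; apply: innerM_eqP => x.
  by have [_ e2] := ay7 a b c d x; exact: esym e2.
by have [e1 e2] := ay9 x a b c d; exact: etrans e1 e2.
Qed.

Lemma Delta_lact xi a b : Delta a (lact xi b) = Delta (ract a xi) b.
Proof.
have [ll _] := lact_bilinear; have [_ rr] := ract_bilinear.
have [Dl Dr] := Delta_bilinear.
apply: (linear_ext (f := fun xi => Delta a (lact xi b))
                   (g := fun xi => Delta (ract a xi) b)).
- by move=> k u v; rewrite ll Dr.
- by move=> k u v; rewrite rr Dl.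
move=> c d; apply: innerM_eqP => x; first exact: ay8.
by symmetry; apply: ay10.
Qed.

Lemma Delta_mul a b c : Delta (a *y b) c = Delta a (b *y c).
Proof. by apply: innerM_eqP => x; [apply: ay2 | apply: ay5]. Qed.

(** * The reductive algebra $\mathcal{M}(A)\oplus A$ *)

Definition circ (u v : innerM A * A) : innerM A * A :=
  (star u.1 v.1 + Delta u.2 v.2, lact u.1 v.2 + ract u.2 v.1 + u.2 *y v.2).

Lemma circ_bilinear : bilinear_op circ.
Proof.
have [ll lr] := lact_bilinear; have [rl rr] := ract_bilinear.
have [Dl Dr] := Delta_bilinear; have [[sl sr] _] := star_algebra.
split=> [v k u u'|u k v v']; rewrite /circ /=.
- rewrite sl Dl ll rl aymul_linearl; congr pair => /=.
    by rewrite scalerDr addrACA.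
  by rewrite [X in X + _ = _]addrACA [LHS]addrACA !scalerDr.
- rewrite sr Dr lr rr aymul_linearr; congr pair => /=.
    by rewrite scalerDr addrACA.
  by rewrite [X in X + _ = _]addrACA [LHS]addrACA !scalerDr.
Qed.

Lemma circA : associative circ.
Proof.
have /bilinear_opD[lDl lDr] := lact_bilinear.
have /bilinear_opD[rDl rDr] := ract_bilinear.
have /bilinear_opD[DDl DDr] := Delta_bilinear.
have [/bilinear_opD[sDl sDr] sA] := star_algebra.
have /bilinear_opD[mDl mDr] := @aymul_bilinear K A.
move=> [xi x] [eta y] [zeta z]; rewrite /circ /=; congr pair.
  rewrite sDl sDr !DDl !DDr sA Delta_star star_Delta Delta_lact Delta_mul.
  by rewrite [RHS](AC (2*3) ((1*3)*((4*2)*5))).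
have AY1 : (x *y y) *y z + [br x, y, z] = x *y (y *y z) + [dbr x, y, z].
  have /eqP := ay1 x y z.
  by rewrite subr_eq0 addrAC subr_eq => /eqP->; rewrite addrC.
rewrite !lDl !lDr !rDl !rDr !mDl !mDr lact_star ract_star lact_Delta ract_Delta.
rewrite lact_ract !mul_ract -mul_lact lact_mul.
(* The triple product and the bracket of $x,y,z$ are brought to the front on each side, where [AY1]
   equates their sums; the other six terms then match one by one. *)
rewrite [LHS](AC (3*2*3) ((8*5)*(1*2*3*4*6*7))).
by rewrite [RHS](AC (2*3*3) ((8*2)*(1*3*6*4*7*5))); congr (_ + _).
Qed.

Lemma circ_reductive :
  reductive circ [pred z | z.2 == 0] [pred z | z.1 == 0].
Proof.
have /bilinear_op0[l0 l0'] := lact_bilinear.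
have /bilinear_op0[r0 r0'] := ract_bilinear.
have /bilinear_op0[D0 D0'] := Delta_bilinear.
have [/bilinear_op0[s0 s0'] _] := star_algebra.
have /bilinear_op0[m0 m0'] := @aymul_bilinear K A.
split.
- by split; [apply: circ_bilinear | apply: circA].
- split=> [|k u v]; rewrite !inE //= => /eqP-> /eqP->.
  by rewrite scaler0 addr0.
- split=> [|k u v]; rewrite !inE //= => /eqP-> /eqP->.
  by rewrite scaler0 addr0.
- exact: direct_sum_prod.
- move=> u v; rewrite !inE /= => /eqP-> /eqP->.
  by rewrite l0' r0 m0 !addr0.
- move=> u v; rewrite !inE /= => /eqP-> /eqP->.
  by rewrite s0' D0 addr0.
- move=> u v; rewrite !inE /= => /eqP-> /eqP->.
  by rewrite s0 D0' addr0.
Qed.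

End InnerAlgebra.

(** * Uniqueness of the operations and the induced structure *)

Theorem theorem3p10 (K : fieldType) (char0 : [pchar K] =i pred0)
    (A : assocYamagutiType K) :
  exists (star : innerM A -> innerM A -> innerM A)
         (lact : innerM A -> A -> A) (ract : A -> innerM A -> A)
         (circ : innerM A * A -> innerM A * A -> innerM A * A),
    (* (i) *)
    (unique (fun f : innerM A -> innerM A -> innerM A =>
       bilinear_op f /\
       forall a b c d : A, f (Delta a b) (Delta c d) = Delta [br a, b, c] d) star
     /\ assoc_algebra star)
    /\
    (* (ii) *)
    (unique (fun f : innerM A -> A -> A =>
       bilinear_op f /\
       forall a b c : A, f (Delta a b) c = sigma a b c) lact
     /\ unique (fun f : A -> innerM A -> A =>
       bilinear_op f /\
       forall a b c : A, f c (Delta a b) = tau a b c) ract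
     /\ bimodule star lact ract
     /\ (forall (a b : A) (xi : innerM A),
          [/\ lact xi (a *y b) = lact xi a *y b,
              ract (a *y b) xi = a *y ract b xi
            & a *y lact xi b = ract a xi *y b]))
    /\
    (* (iii) *)
    (bilinear_op (Delta : A -> A -> innerM A)
     /\ (forall a b c : A, lact (Delta a b) c = [br a, b, c])
     /\ (forall a b c : A, ract a (Delta b c) = [dbr a, b, c])
     /\ (forall (a b : A) (xi : innerM A),
          [/\ star xi (Delta a b) = Delta (lact xi a) b,
              star (Delta a b) xi = Delta a (ract b xi)
            & Delta a (lact xi b) = Delta (ract a xi) b])
     /\ (forall a b c : A, Delta (a *y b) c = Delta a (b *y c)))
    /\
    (* the reductive associative algebra on M(A) (+) A *)
    (let M0 : {pred innerM A * A} := [pred z | z.2 == 0] in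
     let M1 : {pred innerM A * A} := [pred z | z.1 == 0] in
     let inA (x : A) : innerM A * A := (0, x) in
     unique (fun f : innerM A * A -> innerM A * A -> innerM A * A =>
       bilinear_op f /\
       forall a b c d x y : A,
         f (Delta a b, x) (Delta c d, y) =
         (Delta [br a, b, c] d + Delta x y,
          [br a, b, y] + [dbr x, c, d] + x *y y)) circ
     /\ reductive circ M0 M1
     /\ (forall a b : A, induced_mul circ M0 M1 (inA a) (inA b) = inA (a *y b))
     /\ (forall a b c : A,
          induced_br circ M0 M1 (inA a) (inA b) (inA c) = inA [br a, b, c])
     /\ (forall a b c : A,
          induced_dbr circ M0 M1 (inA a) (inA b) (inA c) = inA [dbr a, b, c])).
Proof.
exists star, lact, ract, circ.
have [l_lin l_linr] := @lact_bilinear K A.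
have [r_linl r_lin] := @ract_bilinear K A.
have star_alg := @star_algebra K A; have [s_bilin _] := star_alg.
have [s_linl s_linr] := s_bilin; have [c_linl c_linr] := @circ_bilinear K A.
split; [|split; [|split]].
- split=> //; split=> [|f [[fl fr] fE]].
    by split=> // a b c d; rewrite star_Delta.
  apply/funext => xi; apply/funext => eta.
  (* A competitor agrees on pairs of generators; linearity extends this one argument at a time. *)
  apply: (linear_ext (f := star^~ eta) (g := f^~ eta)) xi => // a b.
  by apply: linear_ext eta => // c d; rewrite star_Delta fE.
- split; [|split; [|split]].
  + split=> // f [[fl fr] fE].
    apply/funext => xi; apply/funext => c.
    by apply: (linear_ext (f := lact^~ c) (g := f^~ c)) xi.
  + split=> // f [[fl fr] fE].
    apply/funext => c; apply/funext => xi.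
    by apply: linear_ext xi.
  + exact: innerM_bimodule.
  + move=> a b xi.
    by split; [apply: lact_mul | apply: mul_ract | apply: mul_lact].
- split; first exact: Delta_bilinear.
  do 2!split=> //; split; last exact: Delta_mul.
  move=> a b xi.
  by split; [apply: star_Delta | apply: Delta_star | apply: Delta_lact].
have circE a b c d x y : circ (Delta a b, x) (Delta c d, y) =
    (Delta [br a, b, c] d + Delta x y, [br a, b, y] + [dbr x, c, d] + x *y y).
  by rewrite /circ /= star_Delta.
have [s0 s0'] := bilinear_op0 s_bilin.
have [l0 l0'] := bilinear_op0 (@lact_bilinear K A).
have [r0 r0'] := bilinear_op0 (@ract_bilinear K A).
have [D0 D0'] := bilinear_op0 (@Delta_bilinear K A).
have [m0 m0'] := bilinear_op0 (@aymul_bilinear K A).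
(* The projections of this product are $\Delta(x,y)$ and $x\cdot y$, and acting by $\Delta(x,y)$ on
   either side returns the two given brackets. *)
have circ_inA (x y : A) : circ (0, x) (0, y) = (Delta x y, x *y y).
  by rewrite /circ /= s0 l0 r0' !add0r.
split; [|split; [|split; [|split]]].
- split=> [|f [[fl fr] fE]]; first by split=> //; split.
  apply/funext => u; apply/funext => v.
  apply: (linear_ext_sum (f := circ^~ v) (g := f^~ v)) u => // a b x.
  by apply: linear_ext_sum v => // c d y; rewrite fE circE.
- exact: circ_reductive.
- by move=> a b; rewrite /induced_mul proj_along_snd circ_inA.
- move=> a b c; rewrite /induced_br proj_along_fst circ_inA /circ /=.
  by rewrite s0' D0 r0 m0 !addr0.
- move=> a b c; rewrite /induced_dbr proj_along_fst circ_inA /circ /=.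
  by rewrite s0 D0' l0 m0' !addr0 add0r.
Qed.
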